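(* Suppose that every consumer's utility function satisfies the utility assumption stated in the context, and that the joint probability distribution of the intermittent supply process $\mathbf{s}$ is absolutely continuous and has compact support. Let $\pi^*=(\sigma^*,\phi)$, where $\sigma^*$ is the EDF inter-class scheduling policy and $\phi\in\Phi(\sigma^* )$ is an arbitrary feasible intra-class scheduling policy, and let $\boldsymbol{\zeta}$ be the marginal cost pricing scheme. Then the mechanism $(\pi^*,\boldsymbol{\zeta})$ is incentive compatible for all consumers of a type $\theta=(k,R,q)$ satisfying $R\ge c_0$; that is, for every consumer $i$ with such a type $\theta_i$, $$V_i^{\pi^*}(\theta_i,\varphi_i^*,\mathbf{x},\boldsymbol{\zeta})\ \ge\ V_i^{\pi^*}(\theta_i,\varphi_i,\mathbf{x},\boldsymbol{\zeta})\qquad\text{for all strategies }\varphi_i\text{ and all }\mathbf{x}\in\mathbb{R}_+^N,$$ where $\varphi_i^*$ is the truth-telling strategy.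
   Context: Fix $N\ge1$ and a price $c_0>0$ of firm supply. The intermittent supply is a random process $\mathbf{s}=(s_0,\dots,s_{N-1})$, each $s_k$ taking values in an interval $\mathcal{S}\subset\mathbb{R}_+$. Consumers. There is a continuum of consumers $i\in[0,1]$ with Lebesgue measure $\eta$. Consumer $i$ has type $\theta_i=(k_i,R_i,q_i)$ in a finite set $\Theta$: deadline $k_i\in\{1,\dots,N\}$, marginal utility $R_i\ge0$, maximum demand $q_i>0$. Utility assumption: a consumer of type $\theta_i$ derives utility $U_{\theta_i}(y)$ from the total energy $y$ received by her deadline $k_i$, where $U_{\theta_i}:\mathbb{R}_+\to\mathbb{R}_+$ is non-negative and non-decreasing on $[0,q_i]$, $U_{\theta_i}(y)\le yR_i$ for all $y\in[0,q_i]$, $R_i=U_{\theta_i}(q_i)/q_i$, and $U_{\theta_i}(y)=U_{\theta_i}(q_i)$ for all $y\ge q_i$. Let $Q=\max_{(k,R,q)\in\Theta}q$. An action is $\mathbf{a}=(a_1,\dots,a_N)\in\mathcal{A}=\{\mathbf{a}\in\mathbb{R}_+^N:\sum_k a_k\le Q\}$, where $a_k$ is the energy guaranteed delivery by deadline $k$. A strategy is a map $\varphi:\Theta\to\mathcal{A}$. The truth-telling strategy $\varphi^*$ maps $\theta=(k,R,q)$ to $\mathbf{a}^*$ with $a_k^*=q$ and $a_j^*=0$ for $j\ne k$. The aggregate demand bundle is $\mathbf{x}\in\mathbb{R}_+^N$, the integral over $i$ of all consumers' actions; a single consumer's action does not affect it. Inter-class scheduling. Given $\mathbf{x}$, set $\mathbf{z}_0=\mathbf{x}$,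 $\mathbf{z}_{k+1}=\mathbf{z}_k-\mathbf{u}_k-\mathbf{v}_k$, $k=0,\dots,N-1$, where $\mathbf{u}_k,\mathbf{v}_k\in\mathbb{R}_+^N$ are the intermittent and firm supply allocated to the demand classes in period $k$. The EDF inter-class policy $\sigma^*$ uses $\mathbf{u}_k=\boldsymbol{\mu}_k^*(\mathbf{z}_k,s_k)$, $\mathbf{v}_k=\boldsymbol{\nu}_k^*(\mathbf{z}_k,s_k)$ with $$\mu_k^{j,*}(\mathbf{z},s)=\min\Big\{z^j,\ s-\sum_{i=1}^{j-1}\mu_k^{i,*}(\mathbf{z},s)\Big\},\qquad \nu_k^{j,*}(\mathbf{z},s)=(z^j-\mu_k^{j,*}(\mathbf{z},s))\mathbf{1}_{\{k=j-1\}}.$$ Intra-class scheduling. An intra-class policy $\phi$ dictates how the supply made available to each class by the inter-class policy is allocated across the consumers within that class. It specifies, for every consumer $i$, aggregate demand $\mathbf{x}$, action $\mathbf{a}$ and period $k$, random vectors $\boldsymbol{\lambda}_{k,i}(\mathbf{x},\mathbf{a})\in\mathbb{R}_+^N$ (depending on the supply realization), where $\lambda^j_{k,i}(\mathbf{x},\mathbf{a})$ is the energy delivered in period $k$ to consumer $i$ towards satisfying her demand $a_j$ (so $\sum_{k=0}^{N-1}\lambda^j_{k,i}(\mathbf{x},\mathbf{a})\le a_j$). It is feasible, $\phi\in\Phi(\sigma^* )$, if: (1) $\lambda^j_{k,i}(\mathbf{x},\mathbf{a})=0$ whenever $a_j=0$; (2) $\lambda^j_{k,i}(\mathbf{x},\mathbf{a})=0$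 for $j\le k$; (3) the supply allocated to class $j$ in period $k$ is fully used by that class: $\int_{[0,1]}\lambda^j_{k,i}\,\eta(di)=u_k^j+v_k^j$ for $0\le k<j\le N$ (each consumer's $\lambda^j_{k,i}$ evaluated at her action, the actions aggregating to $\mathbf{x}$), and energy is delivered from class $j$ only when made available to it: for $k<j-1$, if $u_k^j+v_k^j=0$ then $\lambda^j_{k,i}(\mathbf{x},\mathbf{a})=0$ for every $i\in[0,1]$ and every $\mathbf{a}\in\mathcal{A}$; (4) with $\omega^\pi_{k,i}(\mathbf{x},\mathbf{a})=\sum_{t=0}^{k-1}\sum_{j=1}^N\lambda^j_{t,i}(\mathbf{x},\mathbf{a})$ the energy delivered to consumer $i$ by deadline $k$, one has $\sum_{t=1}^k a_t\le\omega^\pi_{k,i}(\mathbf{x},\mathbf{a})\le\sum_{t=1}^N a_t$ with probability one for $k=1,\dots,N$. Here $\pi=\pi^*=(\sigma^*,\phi)$. Prices and payoffs. A pricing scheme $\boldsymbol{\kappa}$ maps $\mathbf{x}\in\mathbb{R}_+^N$ to a price bundle in $\{\mathbf{p}\in\mathbb{R}_+^N:p_1\ge\cdots\ge p_N\}$. The expected payoff of consumer $i$ is $$V_i^\pi(\theta_i,\varphi_i,\mathbf{x},\boldsymbol{\kappa})=\mathbb{E}\{U_{\theta_i}(\omega^\pi_{k_i,i}(\mathbf{x},\mathbf{a}))\}-\boldsymbol{\kappa}(\mathbf{x})^\top\mathbf{a},\qquad \mathbf{a}=\varphi_i(\theta_i).$$ The residual process is $\xi_0=0$, $\xi_{k+1}=\max\{0,\xi_k\}+s_k-x_{k+1}$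 for $k=0,\dots,N-1$. The marginal cost pricing scheme is $$\zeta_k(\mathbf{x})=c_0\Big[\mathbb{P}(\xi_k\le0)+\sum_{t=k+1}^N\mathbb{P}(\xi_k>0,\dots,\xi_{t-1}>0,\xi_t\le0)\Big],\qquad k=1,\dots,N.$$ *)

(* Defs.v *)
From HB Require Import structures.
From mathcomp Require Import all_boot all_order all_algebra.
From mathcomp Require Import all_classical all_reals all_analysis.
From mathcomp Require Import measurable_realfun.

Set Implicit Arguments.
Unset Strict Implicit.
Unset Printing Implicit Defensive.

Import Order.TTheory GRing.Theory Num.Theory.
Import numFieldNormedType.Exports.

Local Open Scope classical_set_scope.
Local Open Scope ring_scope.

(* Indexing: periods are 0, ..., N-1; demand classes and deadlines 1, ..., N
   are represented by 'I_N, the ordinal j standing for the deadline j.+1. *)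

Section vectors.
Context {R : realType} {N : nat}.

Definition nonneg_vec (x : 'rV[R]_N) : Prop := forall j, 0 <= x 0 j.

(* Coordinate at a natural number, 0 out of range. *)
Definition coord (x : 'rV[R]_N) (k : nat) : R := oapp (x 0) 0 (insub k).

Lemma coord_ord (x : 'rV[R]_N) (k : 'I_N) : coord x k = x 0 k.
Proof. by rewrite /coord valK. Qed.

End vectors.

Section joint_law.
Context {R : realType}.

(* N-dimensional Lebesgue measure, by iterating the formula that defines the
   product measure [\x]. *)
Fixpoint lebesgue_tuple (n : nat) : set (n.-tuple R) -> \bar R :=
  if n is m.+1 return set (n.-tuple R) -> \bar R then
    fun A => (\int[lebesgue_measure]_(y in [set: R])
       lebesgue_tuple [set t : m.-tuple R | A [tuple of y :: t]])%E
  else fun A => \d_([tuple] : 0.-tuple R) A.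

Lemma lebesgue_tuple_box (n : nat) (B : nat -> set R) :
  (forall i, measurable (B i)) ->
  lebesgue_tuple [set t : n.-tuple R | forall i : 'I_n, B i (tnth t i)] =
  (\prod_(i < n) lebesgue_measure (B i))%E.
Proof.
have leb0 m : lebesgue_tuple (set0 : set (m.-tuple R)) = 0%E.
  elim: m => [|m IHm] /=; first by rewrite diracE in_set0.
  under eq_integral do rewrite (_ : [set t | _] = set0) ?IHm//.
  by rewrite integral0.
elim: n B => [|n IHn] B mB /=.
  by rewrite big_ord0 diracE mem_set//= => -[].
rewrite big_ord_recl -(IHn (fun i => B i.+1)); last by move=> i; exact: mB.
set L := lebesgue_tuple _; rewrite [LHS](_ : _ =
    (\int[lebesgue_measure]_(y in [set: R]) (L * (\1_(B 0%N) y)%:E))%E); last first.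
  apply: eq_integral => y _; rewrite indicE.
  have [yB|yB] := pselect (B 0%N y).
    rewrite mem_set// mule1; congr lebesgue_tuple; apply/seteqP.
    split=> t /= H i; first by have := H (lift ord0 i); rewrite tnthS.
    have [->//|i0] := eqVneq i ord0.
    have [j ->] : exists j, i = lift ord0 j.
      by case: (unliftP ord0 i) i0 => [j ->|->]; [exists j|rewrite eqxx].
    by rewrite tnthS; exact: H.
  rewrite memNset// mule0 -(leb0 n); congr lebesgue_tuple; apply/seteqP.
  by split=> t //= /(_ ord0).
have L0 : (0 <= L)%E.
  rewrite /L (IHn (fun i => B i.+1)); last by move=> i; exact: mB.
  by apply: prode_ge0 => i _; exact: measure_ge0.
have mB0 := mB 0%N; rewrite ge0_integralZl//.
  by rewrite (integral_indic lebesgue_measure measurableT mB0) setIT muleC.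
exact/measurable_EFinP/measurable_indic.
Qed.

Definition row_of_tuple (n : nat) (t : n.-tuple R) : 'rV[R]_n :=
  \row_i tnth t i.

(* The topology of R^n is that of 'rV[R]_n: tuples carry only a sigma-algebra. *)
Definition law_support (n : nat) (mu : set (n.-tuple R) -> \bar R) :
    set 'rV[R]_n :=
  [set x | forall e : R, 0 < e -> (0 < mu (@row_of_tuple n @^-1` ball x e))%E].

End joint_law.

Section consumers.
Context {R : realType} {N : nat}.

Definition consumers : set R := `[0, 1]%classic.

Record ctype := CType {
  deadline : 'I_N;
  marginal : R;
  demand : R
}.

Definition valid_types (Theta : set ctype) : Prop :=
  [/\ finite_set Theta,
      (forall th, Theta th -> 0 <= marginal th) &
      (forall th, Theta th -> 0 < demand th)].

(* A maximum, since Theta is finite. *)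
Definition max_demand (Theta : set ctype) : R := sup (demand @` Theta).

Definition utility_assumption (th : ctype) (U : R -> R) : Prop :=
  let q := demand th in
  [/\ (forall y, 0 <= y <= q -> 0 <= U y),
      (forall y y', 0 <= y -> y <= y' -> y' <= q -> U y <= U y'),
      (forall y, 0 <= y <= q -> U y <= y * marginal th),
      marginal th = U q / q &
      (forall y, q <= y -> U y = U q)].

Definition action_space (Q : R) : set 'rV[R]_N :=
  [set a | nonneg_vec a /\ \sum_j a 0 j <= Q].

Definition is_strategy (Theta : set ctype) (phi : ctype -> 'rV[R]_N) : Prop :=
  forall th, Theta th -> action_space (max_demand Theta) (phi th).

Definition truth_telling (th : ctype) : 'rV[R]_N :=
  \row_j (if j == deadline th then demand th else 0).

Definition action_profile (Q : R) (alpha : R -> 'rV[R]_N) (x : 'rV[R]_N) :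
    Prop :=
  [/\ (forall i, consumers i -> action_space Q (alpha i)),
      (forall j, measurable_fun consumers (fun i => alpha i 0 j)) &
      (forall j, (\int[lebesgue_measure]_(i in consumers) (alpha i 0 j)%:E)%E
                 = (x 0 j)%:E)].

(* acts x i is the action taken by consumer i when the aggregate demand is x;
   nothing is required for those x that no action profile aggregates to. *)
Definition population_actions (Q : R) (acts : 'rV[R]_N -> R -> 'rV[R]_N) :
    Prop :=
  forall x, nonneg_vec x -> (exists alpha, action_profile Q alpha x) ->
    action_profile Q (acts x) x.

End consumers.
Arguments ctype R N : clear implicits.

Section inter_class.
Context {R : realType} {N : nat}.

(* Intermittent and firm supply allocated to the classes in a period, given the
   residual demands and the intermittent supply of that period. *)
Record inter_policy := InterPolicy {
  inter_mu : nat -> 'rV[R]_N -> R -> 'rV[R]_N;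
  inter_nu : nat -> 'rV[R]_N -> R -> 'rV[R]_N
}.

Fixpoint residual_demand (sigma : inter_policy) (x : 'rV[R]_N)
    (s : N.-tuple R) (k : nat) : 'rV[R]_N :=
  if k is k'.+1 then
    let z := residual_demand sigma x s k' in
    z - inter_mu sigma k' z s`_k' - inter_nu sigma k' z s`_k'
  else x.

(* u_k + v_k *)
Definition class_supply (sigma : inter_policy) (x : 'rV[R]_N)
    (s : N.-tuple R) (k : nat) : 'rV[R]_N :=
  let z := residual_demand sigma x s k in
  inter_mu sigma k z s`_k + inter_nu sigma k z s`_k.

(* Total EDF allocation of the supply r to the first j classes. *)
Fixpoint edf_served (z : 'rV[R]_N) (r : R) (j : nat) : R :=
  if j is j'.+1 then
    edf_served z r j' + Num.min (coord z j') (r - edf_served z r j')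
  else 0.

Definition edf_mu (z : 'rV[R]_N) (r : R) : 'rV[R]_N :=
  \row_j Num.min (z 0 j) (r - edf_served z r j).

Lemma edf_muE (z : 'rV[R]_N) (r : R) (j : 'I_N) :
  edf_mu z r 0 j =
  Num.min (z 0 j) (r - \sum_(i < N | (i < j)%N) edf_mu z r 0 i).
Proof.
rewrite mxE; congr (Num.min _ (_ - _)).
have [m jm] : exists m, nat_of_ord j = m by exists j.
have : (m <= N)%N by rewrite -jm ltnW.
rewrite jm; elim: m {j jm} => [|m IHm] mN; first by rewrite big_pred0.
rewrite [RHS](bigD1 (Ordinal mN)) //= addrC mxE /=.
rewrite -(coord_ord _ (Ordinal mN)) /= (IHm (ltnW mN)); congr (_ + _).
by apply: eq_bigl => i; rewrite ltnS -val_eqE /= ltn_neqAle andbC.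
Qed.

Definition edf : inter_policy := InterPolicy
  (fun _ z r => edf_mu z r)
  (fun k z r => \row_j (if k == j then z 0 j - edf_mu z r 0 j else 0)).

End inter_class.
Arguments inter_policy R N : clear implicits.

Section mechanism.
Context {d : measure_display} {Omega : measurableType d} {R : realType}
  {P : probability Omega R} {N : nat}.
Implicit Types (s : {RV P >-> N.-tuple R}) (x a : 'rV[R]_N).

(* lam i x a k j: energy delivered in period k to consumer i, reporting a,
   towards her demand for class j. *)
Definition intra_policy :=
  R -> 'rV[R]_N -> 'rV[R]_N -> 'I_N -> 'I_N -> {RV P >-> R}.

(* Energy delivered in periods 0, ..., k-1. *)
Definition delivered (lam : intra_policy) (i : R) x a (k : nat) (w : Omega) :
    R :=
  \sum_(t < N | (t < k)%N) \sum_(j < N) lam i x a t j w.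

(* The set Phi(sigma), for the population actions acts. Full use constrains only
   the population's own actions; the other conditions hold at every action. For
   the class j.+1, [k < j] is the condition "before the last period". *)
Record feasible_intra (Q : R) (acts : 'rV[R]_N -> R -> 'rV[R]_N) s
    (sigma : inter_policy R N) (lam : intra_policy) : Prop := FeasibleIntra {
  lam_ge0 : forall i x a, consumers i -> nonneg_vec x -> action_space Q a ->
    forall k j w, 0 <= lam i x a k j w;
  lam_le_demand : forall i x a, consumers i -> nonneg_vec x ->
    action_space Q a ->
    forall j w, \sum_(k < N) lam i x a k j w <= a 0 j;
  lam_no_demand : forall i x a, consumers i -> nonneg_vec x ->
    action_space Q a ->
    forall k j w, a 0 j = 0 -> lam i x a k j w = 0;
  lam_expired : forall i x a, consumers i -> nonneg_vec x ->
    action_space Q a ->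
    forall (k j : 'I_N) w, (j.+1 <= k)%N -> lam i x a k j w = 0;
  lam_full_use : forall x, nonneg_vec x -> action_profile Q (acts x) x ->
    forall (k j : 'I_N) w, (k < j.+1)%N ->
      measurable_fun consumers (fun i => lam i x (acts x i) k j w) /\
      (\int[lebesgue_measure]_(i in consumers)
         (lam i x (acts x i) k j w)%:E)%E =
      (class_supply sigma x (s w) k 0 j)%:E;
  lam_available : forall i x a, consumers i -> nonneg_vec x ->
    action_space Q a ->
    forall (k j : 'I_N) w, (k < j)%N ->
      class_supply sigma x (s w) k 0 j = 0 -> lam i x a k j w = 0;
  lam_deadlines : forall i x a, consumers i -> nonneg_vec x ->
    action_space Q a ->
    forall k : nat, (1 <= k <= N)%N ->
      {ae P, forall w,
        \sum_(t < N | (t < k)%N) a 0 t <= delivered lam i x a k w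
        <= \sum_(t < N) a 0 t}
}.

Definition payoff (lam : intra_policy) (U : R -> R) (i : R)
    (th : ctype R N) (phi : ctype R N -> 'rV[R]_N) x
    (kappa : 'rV[R]_N -> 'rV[R]_N) : \bar R :=
  ('E_P[fun w => U (delivered lam i x (phi th) (deadline th).+1 w)]
   - (\sum_j kappa x 0 j * phi th 0 j)%:E)%E.

Definition incentive_compatible (Theta : set (ctype R N))
    (lam : intra_policy) (kappa : 'rV[R]_N -> 'rV[R]_N)
    (U : R -> R) (i : R) (th : ctype R N) : Prop :=
  forall phi, is_strategy Theta phi -> forall x, nonneg_vec x ->
    (payoff lam U i th phi x kappa <=
     payoff lam U i th truth_telling x kappa)%E.

Fixpoint xi x (s : N.-tuple R) (k : nat) : R :=
  if k is k'.+1 then Num.max 0 (xi x s k') + s`_k' - coord x k' else 0.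

Definition marginal_cost_price (c0 : R) s x : 'rV[R]_N :=
  \row_(j < N) (c0 *
    (fine (P [set w | xi x (s w) j.+1 <= 0]) +
     \sum_(j.+2 <= t < N.+1)
       fine (P [set w | (forall r : nat, (j.+1 <= r < t)%N ->
                                         0 < xi x (s w) r)
                        /\ xi x (s w) t <= 0]))).

End mechanism.
Arguments intra_policy {d Omega R} P N.

(* Main.v *)
Require Import Defs.
From HB Require Import structures.
From mathcomp Require Import all_boot all_order all_algebra.
From mathcomp Require Import all_classical all_reals all_analysis.
From mathcomp Require Import measurable_realfun.
From mathcomp Require Import ring lra zify.

Set Implicit Arguments.
Unset Strict Implicit.
Unset Printing Implicit Defensive.

Import Order.TTheory GRing.Theory Num.Theory.
Import numFieldNormedType.Exports.

Local Open Scope classical_set_scope.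
Local Open Scope ring_scope.

(* Write E_j for the event that xi_t <= 0 for some t >= j. The first-hit events
   in the definition of zeta_j partition E_j, so zeta_j = c0 P(E_j). Under EDF a
   class j receives energy in a period t < j - 1 only if the intermittent supply
   more than covers all the classes before j, which forces xi_{t+1}, ...,
   xi_{j-1} > 0. Hence, for a consumer with deadline k, on E_k the energy for
   j > k delivered before the deadline comes from classes with E_j true: on E_k
   she receives at most sum_j a_j 1_{E_j} by her deadline. Since
   U(y) <= R min(y, q) and R >= c0,
     U(omega) + c0 q 1_{E_k} <= R q + c0 sum_j a_j 1_{E_j}
   holds pointwise; its expectation is the claim, as truth-telling delivers q
   almost surely. *)

Ltac minmax_free t :=
  lazymatch t with
  | context [Order.max _ _] => fail
  | context [Order.min _ _] => fail
  | _ => idtac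
  end.

(* Innermost first, so that no hypothesis is left with a [min] or a [max]. *)
Ltac case_minmax :=
  repeat match goal with
  | |- context [Order.max ?a ?b] =>
      minmax_free a; minmax_free b; case: (leP a b) => ?
  | |- context [Order.min ?a ?b] =>
      minmax_free a; minmax_free b; case: (leP a b) => ?
  end.

(** * EDF allocation and the residual process *)

Section edf_scheduling.
Context {R : realType} {N : nat}.
Local Notation coord := (@Defs.coord R N).
Implicit Types (x z : 'rV[R]_N) (s : N.-tuple R).

Lemma coord_ge0 x m : nonneg_vec x -> 0 <= coord x m.
Proof. by move=> x0; rewrite /coord; case: insubP => //= j _ _; exact: x0. Qed.

Lemma coordB x z m : coord (x - z) m = coord x m - coord z m.
Proof.
by rewrite /coord; case: insubP => /= [j _ _|_]; rewrite ?mxE ?subr0.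
Qed.

(** EDF is greedy: a class is cut short only once the supply has run out. *)
Lemma edf_served_min z r m : nonneg_vec z -> 0 <= r ->
  edf_served z r m = Num.min r (\sum_(0 <= i < m) coord z i).
Proof.
move=> z0 r0; elim: m => [|m IHm] /=; first by rewrite big_geq// min_r.
rewrite IHm big_nat_recr//=.
have := coord_ge0 m z0; set Z := \sum_(_ <= _ < _) _; set c := coord z m => c0.
by rewrite !minElt; repeat case: ltP => ?; lra.
Qed.

Lemma edf_mu_ge0 z r j : nonneg_vec z -> 0 <= r -> 0 <= edf_mu z r 0 j.
Proof.
move=> z0 r0; rewrite mxE le_min z0 edf_served_min//.
by rewrite subr_ge0 ge_min lexx.
Qed.

(** The class of index [m] has deadline [m.+1], so period [m] is its last one and firm supply then
    clears it. *)
Lemma coord_edf_step x s k m : (m < N)%N ->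
  let z := residual_demand edf x s k in
  coord (residual_demand edf x s k.+1) m =
  if k == m then 0
  else coord z m - Num.min (coord z m) (s`_k - edf_served z s`_k m).
Proof.
move=> mN /=; set z := residual_demand _ _ _ _.
rewrite !coordB -[m]/(nat_of_ord (Ordinal mN)) !coord_ord !mxE /=.
by case: eqP => ?; rewrite ?subr0//; ring.
Qed.

Lemma sum_edf_unserved z r m :
  \sum_(0 <= i < m) (coord z i - Num.min (coord z i) (r - edf_served z r i)) =
  \sum_(0 <= i < m) coord z i - edf_served z r m.
Proof.
elim: m => [|m IHm] /=; first by rewrite !big_geq// subr0.
by rewrite !big_nat_recr//= IHm; ring.
Qed.

(* When xi_k > 0 it is the intermittent supply left over by the first k classes,
   counting what was wasted for lack of demand; hence the outer [max]. *)
Lemma sum_residual_demand x s k :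
  nonneg_vec x -> (forall i, 0 <= s`_i) -> (k <= N)%N ->
  let z := residual_demand edf x s k in
  [/\ nonneg_vec z, (forall i, (i < k)%N -> coord z i = 0) &
      forall m, (k <= m <= N)%N -> \sum_(0 <= i < m) coord z i =
        Num.max 0 (\sum_(k <= i < m) coord x i - Num.max 0 (xi x s k))].
Proof.
move=> x0 s0; elim: k => [|k IHk] kN.
  split => //= m _; rewrite maxxx subr0 max_r//.
  by apply: sumr_ge0 => i _; exact: coord_ge0.
have [z0 zk zsum] := IHk (ltnW kN).
have step := coord_edf_step x s k.
cbv zeta in step |- *; set z' := residual_demand edf x s k.+1 in step *.
set z := residual_demand edf x s k in z0 zk zsum step.
have Zk i : (i <= k)%N -> \sum_(0 <= l < i) coord z l = 0.
  move=> ik; rewrite big_nat_cond big1// => l /andP[/andP[_ li] _].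
  by apply: zk; exact: leq_trans li ik.
have z'k i : (i < k.+1)%N -> coord z' i = 0.
  move=> ik; rewrite step; last lia.
  case: eqP => // nik; rewrite zk; last lia.
  by rewrite min_l ?subr0// subr_ge0 edf_served_min// Zk// ge_min lexx.
split => //.
  move=> j; rewrite -coord_ord; case: (ltnP j k.+1) => jk; first by rewrite z'k.
  rewrite step//; case: eqP => // _.
  by rewrite subr_ge0 ge_min lexx.
move=> m km.
(* Firm supply removes what class [k] still lacks; the earlier classes lack nothing, so this is the
   whole unserved demand of the first [k.+1] classes. *)
have unserved : \sum_(0 <= i < m) coord z' i =
    (\sum_(0 <= i < m) coord z i - edf_served z s`_k m) -
    (\sum_(0 <= i < k.+1) coord z i - edf_served z s`_k k.+1).
  rewrite -!sum_edf_unserved !(@big_cat_nat _ _ _ k.+1 0 m)//=; last 2 first.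
  - by case/andP: km.
  - by case/andP: km.
  rewrite [X in X + _]big_nat_cond [X in X + _]big1; last first.
    by move=> i /andP[/andP[_ ik] _]; exact: z'k.
  rewrite add0r [RHS]addrC addrA addNr add0r; apply: eq_big_nat => i ikm.
  by rewrite step ?ifN//; lia.
(* The closed forms leave a piecewise linear identity in [xi_k], [s_k], [x_k] and the later demands
   [X]. *)
rewrite unserved !edf_served_min// !zsum; [|lia..].
rewrite big_nat1 (@big_ltn _ _ _ k m); last by case/andP: km.
have : 0 <= \sum_(k.+1 <= i < m) coord x i.
  by apply: sumr_ge0 => i _; exact: coord_ge0.
move: (s0 k) (coord_ge0 k x0) => /=.
set X := \sum_(_ <= _ < _) _; set sk := s`_k; set xk := coord x k.
move: (xi x s k) => y sk0 xk0 X0.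
by case_minmax; lra.
Qed.

(** Before its last period a class gets no firm supply, and intermittent supply reaches it only
    after meeting all that the earlier classes still lack. *)
Lemma xi_gt0_of_class_supply x s (k j : 'I_N) :
  nonneg_vec x -> (forall i, 0 <= s`_i) -> (k < j)%N ->
  class_supply edf x s k 0 j != 0 ->
  forall m, (k < m <= j)%N -> 0 < xi x s m.
Proof.
move=> x0 s0 kj u_neq0.
have [z0 _ zsum] := sum_residual_demand x0 s0 (ltnW (ltn_ord k)).
set z := residual_demand edf x s k in z0 zsum.
have {u_neq0} u_gt0 : 0 < edf_mu z s`_k 0 j.
  rewrite lt_neqAle eq_sym edf_mu_ge0// andbT.
  apply: contra_neq u_neq0 => u0.
  by rewrite /class_supply /= mxE u0 mxE ltn_eqF// addr0.
have surplus : \sum_(k.+1 <= i < j) coord x i < xi x s k.+1.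
  move: u_gt0; rewrite mxE lt_min => /andP[_].
  rewrite edf_served_min// zsum; last by rewrite ltnW//= ltnW.
  rewrite big_ltn//= -/(s`_k).
  set X := \sum_(_ <= _ < _) _; move: (xi x s k) (s`_k) (coord x k) => y sk xk.
  by case_minmax; lra.
(* Positivity alone is not inductive. Passing from [m] to [m.+1] takes [x_m] off both sides and adds
   supply to [xi], so the strict surplus over the demand still due persists. *)
have surplusm m : (k < m <= j)%N -> \sum_(m <= i < j) coord x i < xi x s m.
  elim: m => [//|m IHm] /andP[km mj]; move: km; rewrite ltnS leq_eqVlt.
  case/predU1P => [<-//|km].
  have := IHm; rewrite km ltnW//= => /(_ isT); rewrite big_ltn//=.
  have := s0 m; move: (\sum_(_ <= _ < _) _) (s`_m) (coord x m) => X sm xm.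
  by case_minmax; lra.
move=> m kmj; apply: le_lt_trans (surplusm m kmj).
by apply: sumr_ge0 => i _; exact: coord_ge0.
Qed.

End edf_scheduling.

(** * Decomposition of a union by first hitting time *)

Section first_hit.
Context d (T : measurableType d) (R : realType) (P : probability T R).

(** Each point of the union is counted once, at its first index. In the induction, the event added
    at [n.+1] is [B n.+1] minus the union so far. *)
Lemma probability_first_hit (B : nat -> set T) a n :
  (forall t, measurable (B t)) -> (a <= n)%N ->
  fine (P (B a)) + \sum_(a.+1 <= t < n.+1)
    fine (P [set w | (forall r, (a <= r < t)%N -> ~ B r w) /\ B t w]) =
  fine (P (\bigcup_(t in [set t | (a <= t <= n)%N]) B t)).
Proof.
move=> mB; elim: n => [|n IHn] an.
  move: an; rewrite leqn0 => /eqP ->; rewrite big_geq// addr0.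
  congr (fine (P _)); apply/seteqP; split=> [w Bw|w [t /= t0]].
    by exists 0%N.
  by have -> : t = 0%N by lia.
move: an; rewrite leq_eqVlt => /predU1P[->|an].
  rewrite big_geq// addr0.
  congr (fine (P _)); apply/seteqP; split=> [w Bw|w [t /= tn]].
    by exists n.+1 => //=; rewrite leqnn.
  by have -> : t = n.+1 by lia.
have mU m : measurable (\bigcup_(t in [set t | (a <= t <= m)%N]) B t).
  exact: bigcup_measurable.
rewrite big_nat_recr//= addrA IHn//.
set C := [set w | _ /\ _].
have CE : C = B n.+1 `\` \bigcup_(t in [set t | (a <= t <= n)%N]) B t.
  apply/seteqP; split=> w /= [].
    move=> notB Bw; split => // -[t /= tn]; apply: notB; lia.
  by move=> Bw notB; split=> // r rn Br; apply: notB; exists r => //=; lia.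
have mC : measurable C by rewrite CE; exact: measurableD.
rewrite -fineD; [|exact: fin_num_measure..].
rewrite -measureU//; last first.
  by rewrite CE setDIK.
congr (fine (P _)); apply/seteqP; split=> [w []|w [t /= tn Bt]].
- by move=> [t /= tn Bt]; exists t => //=; lia.
- by move=> [_ Bt]; exists n.+1 => //=; lia.
- move: tn => /andP[le_at]; rewrite leq_eqVlt ltnS.
  move=> /predU1P[tn|tn]; last first.
    by left; exists t => //=; rewrite le_at.
  rewrite CE -tn.
  have [|] := pselect ((\bigcup_(t in [set t | (a <= t <= n)%N]) B t) w).
    by left.
  by right.
Qed.

End first_hit.

(** * Prices, deliveries and utilities *)

Section mechanism.
Context {d : measure_display} {Omega : measurableType d} {R : realType}
  {P : probability Omega R} {N : nat}.
Implicit Types (s : {RV P >-> N.-tuple R}) (x a : 'rV[R]_N).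

Lemma measurable_xi x s k : (k <= N)%N ->
  measurable_fun [set: Omega] (fun w => xi x (s w) k).
Proof.
elim: k => [//|k IHk] kN /=.
apply: measurable_funB; last exact: measurable_cst.
apply: measurable_funD.
  by apply: measurable_maxr; [exact: measurable_cst|exact/IHk/ltnW].
rewrite [X in measurable_fun _ X](_ : _ = fun w => tnth (s w) (Ordinal kN)).
  by apply: (measurableT_comp (measurable_tnth (Ordinal kN))).
by apply/funext => w; rewrite (tnth_nth 0).
Qed.

(* zeta_j sums the probabilities of the disjoint events that a given t >= j is
   the first one with xi_t <= 0, i.e. it is c0 times that of their union. *)
Definition exhausted x s (j : 'I_N) : set Omega :=
  \bigcup_(t in [set t | (j.+1 <= t <= N)%N]) [set w | xi x (s w) t <= 0].

Lemma measurable_xi_le0 x s t : (t <= N)%N ->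
  measurable [set w | xi x (s w) t <= 0].
Proof.
move=> tN; rewrite -[X in measurable X]setTI.
have := measurable_fun_ler (measurable_xi x s tN) (measurable_cst (0 : R)).
by move=> /(_ measurableT [set true]); exact.
Qed.

Lemma measurable_exhausted x s j : measurable (exhausted x s j).
Proof.
by apply: bigcup_measurable => t /= /andP[_ tN]; exact: measurable_xi_le0.
Qed.

Lemma marginal_cost_priceE c0 s x (j : 'I_N) :
  marginal_cost_price c0 s x 0 j = c0 * fine (P (exhausted x s j)).
Proof.
rewrite mxE; congr (_ * _).
(* The conjunct [t <= N] empties [B] beyond the horizon, which makes it measurable for every [t], as
   the first-hit identity asks. *)
pose B t := [set w | (t <= N)%N /\ xi x (s w) t <= 0].
have BE t : (t <= N)%N -> B t = [set w | xi x (s w) t <= 0].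
  by move=> tN; apply/seteqP; split=> w //= [].
have mB t : measurable (B t).
  have [tN|tN] := leqP t N; first by rewrite BE//; exact: measurable_xi_le0.
  by rewrite (_ : B t = set0)//; apply/seteqP; split=> w //= []; lia.
have := probability_first_hit P mB (ltn_ord j).
rewrite BE//= => hit.
rewrite [in RHS](_ : exhausted x s j =
  \bigcup_(t in [set t | (j < t <= N)%N]) B t).
  rewrite -hit; congr (_ + _); apply: eq_big_nat => t tN.
  congr (fine (P _)); rewrite BE; last lia.
  apply/seteqP; split=> w /= [pos le0]; split=> // r rt.
    by case=> _; rewrite leNgt pos.
  by rewrite ltNge; apply/negP => ?; apply: (pos r rt); split=> //; lia.
by apply: eq_bigcupr => t /= /andP[_ tN]; rewrite BE.
Qed.

Lemma delivered_ge0 (Q : R) acts s sigma (lam : intra_policy P N) i x a k w :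
  feasible_intra Q acts s sigma lam -> consumers i -> nonneg_vec x ->
  action_space Q a -> 0 <= delivered lam i x a k w.
Proof.
move=> hlam ci x0 aQ; apply: sumr_ge0 => t _; apply: sumr_ge0 => j _.
exact: (lam_ge0 hlam).
Qed.

(** A class with [E_j] contributes at most its demand. Any other contributes nothing in periods up
    to [k]: a delivery there would keep [xi] positive through [j]. *)
Lemma delivered_exhausted (Q : R) acts s (lam : intra_policy P N) i x a
    (k : 'I_N) w :
  (forall m, 0 <= (s w)`_m) ->
  feasible_intra Q acts s edf lam -> consumers i -> nonneg_vec x ->
  action_space Q a -> exhausted x s k w ->
  delivered lam i x a k.+1 w <= \sum_j a 0 j * \1_(exhausted x s j) w.
Proof.
move=> s0 hlam ci x0 aQ [m /= km xim]; rewrite /delivered exchange_big /=.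
apply: ler_sum => j _; rewrite indicE.
have [Ej|nEj] := pselect (exhausted x s j w).
  rewrite mem_set// mulr1; apply: le_trans (lam_le_demand hlam ci x0 aQ j w).
  rewrite [leRHS](bigID (fun t : 'I_N => (t < k.+1)%N))/= lerDl.
  by apply: sumr_ge0 => t _; exact: (lam_ge0 hlam).
rewrite memNset// mulr0 big1// => t tk.
(* The time [m] that witnesses [E_k] cannot witness [E_j], so it comes no later than [j]; hence
   [t <= k < m <= j]. *)
have mj : (m <= j)%N.
  rewrite leqNgt; apply/negP => jm; apply: nEj; exists m => //=.
  by case/andP: km => _ ->; rewrite jm.
have tj : (t < j)%N by lia.
apply: (lam_available hlam) => //; apply/eqP.
apply: contraT => /(xi_gt0_of_class_supply x0 s0 tj) /(_ m) xim_gt0.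
by move: xim; rewrite leNgt xim_gt0//; lia.
Qed.

(** The assumption controls [U] only on nonnegative arguments; truncation at 0 makes it monotone on
    the whole line and changes nothing at delivered energies. *)
Lemma utility_measurable (th : ctype R N) U : 0 <= demand th ->
  utility_assumption th U ->
  measurable_fun setT (fun y : R => U (Num.max 0 y)).
Proof.
move=> q0 [_ Und _ _ Uq]; apply: nondecreasing_measurable => // y y' yy'.
have U2 u v : 0 <= u -> u <= v -> U u <= U v.
  move=> u0 uv; have [vq|qv] := leP v (demand th); first exact: Und.
  rewrite (Uq v (ltW qv)); have [uq|qu] := leP u (demand th); first exact: Und.
  by rewrite (Uq u (ltW qu)).
by apply: U2; case_minmax; lra.
Qed.

Lemma utility_ge0 (th : ctype R N) U y : 0 <= demand th ->
  utility_assumption th U -> 0 <= y -> 0 <= U y.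
Proof.
move=> q0 [U0 _ _ _ Uq] y0; have [yq|qy] := leP y (demand th).
  by apply: U0; rewrite y0.
by rewrite Uq ?U0 ?q0 ?lexx// ltW.
Qed.

Lemma utility_demand (th : ctype R N) U : 0 < demand th ->
  utility_assumption th U -> U (demand th) = marginal th * demand th.
Proof. by move=> q0 [_ _ _ -> _]; rewrite divfK// gt_eqF. Qed.

(** With [r] the marginal utility and [q] the demand: for [y <= q], the bound [U y <= y * r] leaves
    the slack [(r - c0) * (q - y) >= 0]; beyond [q], [U] stays at [r * q] while
    [c0 * q <= c0 * y]. *)
Lemma utility_surplus (th : ctype R N) U c0 y : 0 < demand th ->
  utility_assumption th U -> 0 <= c0 <= marginal th -> 0 <= y ->
  U y + c0 * demand th <= marginal th * demand th + c0 * y.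
Proof.
move=> q0 hU /andP[c00 c0r] y0.
have [yq|qy] := leP y (demand th).
  have [_ _ Ule _ _] := hU.
  have /Ule : 0 <= y <= demand th by rewrite y0.
  by nra.
have [_ _ _ _ ->] := hU; last exact: ltW.
by rewrite (utility_demand q0 hU); nra.
Qed.

Lemma utility_le (th : ctype R N) U y : 0 < demand th ->
  utility_assumption th U -> 0 <= marginal th -> 0 <= y ->
  U y <= marginal th * demand th.
Proof.
move=> q0 hU r0 y0.
have := @utility_surplus th U 0 y q0 hU; rewrite lexx r0 !mul0r !addr0; exact.
Qed.

Lemma measurable_utility_delivered (lam : intra_policy P N) (th : ctype R N) U
    i x a k : 0 <= demand th -> utility_assumption th U ->
  (forall w, 0 <= delivered lam i x a k w) ->
  measurable_fun setT (fun w => U (delivered lam i x a k w)).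
Proof.
move=> q0 hU om0.
have mD : measurable_fun setT (delivered lam i x a k).
  rewrite /delivered; under eq_fun do rewrite big_mkcond.
  by apply: measurable_sum => t; case: (t < k)%N => //; exact: measurable_sum.
have -> : (fun w => U (delivered lam i x a k w)) =
    (fun y : R => U (Num.max 0 y)) \o delivered lam i x a k.
  by apply/funext => w /=; rewrite max_r.
exact: measurableT_comp (utility_measurable q0 hU) mD.
Qed.

End mechanism.

(** * Truth-telling against an arbitrary strategy *)

Lemma truth_telling_action (R : realType) (N : nat) (Theta : set (ctype R N))
    (th : ctype R N) :
  valid_types Theta -> Theta th ->
  action_space (max_demand Theta) (truth_telling th).
Proof.
move=> [finT _ q_gt0] Tth; split=> [j|].
  by rewrite mxE; case: ifP => // _; exact/ltW/q_gt0.
rewrite (bigD1 (deadline th))//= big1 ?addr0 => [|j jk].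
  rewrite mxE eqxx; apply: ub_le_sup; last by exists th.
  have /finite_seqP[n Dn] := finite_image (@demand R N) finT.
  (* Any upper bound makes the supremum meaningful; the sum of absolute values over the finite image
     is one. *)
  exists (\sum_(y <- n) `|y|) => y; rewrite Dn => /= yn.
  rewrite (big_rem y)//= (le_trans (ler_norm _))// lerDl.
  by apply: sumr_ge0.
by rewrite mxE (negbTE jk).
Qed.

Theorem theorem3 (d : measure_display) (Omega : measurableType d)
  (R : realType) (P : probability Omega R)
  (N : nat) (hN : (1 <= N)%N) (c0 : R) (hc0 : 0 < c0)
  (S : set R) (hS : is_interval S) (hS0 : S `<=` [set r | 0 <= r])
  (s : {RV P >-> N.-tuple R})
  (hs : forall (w : Omega) (k : 'I_N), S (tnth (s w) k))
  (hac : distribution P s `<< @lebesgue_tuple R N)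
  (hsupp : compact (law_support (distribution P s)))
  (Theta : set (ctype R N)) (hTheta : valid_types Theta)
  (theta : R -> ctype R N) (htheta : forall i, consumers i -> Theta (theta i))
  (U : ctype R N -> R -> R)
  (hU : forall i, consumers i -> utility_assumption (theta i) (U (theta i)))
  (acts : 'rV[R]_N -> R -> 'rV[R]_N)
  (hacts : population_actions (max_demand Theta) acts)
  (lam : intra_policy P N)
  (hlam : feasible_intra (max_demand Theta) acts s edf lam) :
  forall i, consumers i -> c0 <= marginal (theta i) ->
    incentive_compatible Theta lam (marginal_cost_price c0 s)
      (U (theta i)) i (theta i).
Proof.
move=> i ci c0r phi phi_strat x x0; rewrite /payoff.
have Tth := htheta i ci; have Uth := hU i ci.
have [_ _ q_gt0] := hTheta; have {q_gt0} := q_gt0 _ Tth.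
have aQ := phi_strat _ Tth; have tQ := truth_telling_action hTheta Tth.
move: (phi (theta i)) aQ => a aQ; move: (theta i) (U (theta i)) c0r Uth Tth tQ.
move=> th u c0r Uth Tth tQ q_gt0; have [a0 _] := aQ.
have q_ge0 := ltW q_gt0; have c00 := ltW hc0.
have r0 : 0 <= marginal th := le_trans c00 c0r.
(* Entries beyond the horizon take the default value 0, so the sign holds at every index. *)
have s0 w m : 0 <= (s w)`_m.
  have [mN|Nm] := ltnP m N; last by rewrite nth_default ?size_tuple.
  by rewrite -(tnth_nth 0 (s w) (Ordinal mN)); exact/hS0/hs.
pose k := deadline th; pose E := exhausted x s.
have om0 b w : action_space (max_demand Theta) b ->
    0 <= delivered lam i x b k.+1 w.
  by move=> bQ; exact: delivered_ge0 hlam ci x0 bQ.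
have mU b : action_space (max_demand Theta) b ->
    measurable_fun setT (fun w => u (delivered lam i x b k.+1 w)).
  move=> bQ; apply: measurable_utility_delivered q_ge0 Uth _ => w; exact: om0.
have mI j : measurable_fun setT (\1_(E j) : Omega -> R).
  by apply: measurable_indic; exact: measurable_exhausted.
have int_cst (r1 : R) : (\int[P]_w r1%:E)%E = r1%:E.
  by rewrite -[RHS]mule1 -(probability_setT P) -integral_cst.
have truth : ((marginal th * demand th)%:E <=
    'E_P[fun w => u (delivered lam i x (truth_telling th) k.+1 w)])%E.
  rewrite unlock -int_cst.
  apply: ae_ge0_le_integral => //.
  - by move=> w _; rewrite lee_fin mulr_ge0.
  - by move=> w _; rewrite lee_fin (utility_ge0 q_ge0 Uth)// om0.
  - exact/measurable_EFinP/mU.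
  (* Both bounds of the deadline condition reduce to the single demand [q], which pins the delivery
     almost surely. *)
  have := lam_deadlines hlam ci x0 tQ (k := k.+1) (ltn_ord k).
  apply: filterS => w /andP[lo hi] _; rewrite lee_fin.
  have -> : delivered lam i x (truth_telling th) k.+1 w = demand th.
    move: lo hi; rewrite /k.
    rewrite (bigD1 (deadline th))//= (bigD1 (deadline th) (P := xpredT))//=.
    rewrite !big1 => [|j /negPf jk|j /andP[_ /negPf jk]];
      rewrite ?mxE ?eqxx ?jk//.
    by rewrite addr0 => lo hi; apply/eqP; rewrite eq_le lo hi.
  by rewrite (utility_demand q_gt0 Uth).
have pointwise w :
    u (delivered lam i x a k.+1 w) + c0 * demand th * \1_(E k) w <=
    marginal th * demand th + \sum_j c0 * a 0 j * \1_(E j) w.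
  have sumE : \sum_j c0 * a 0 j * \1_(E j) w = c0 * \sum_j a 0 j * \1_(E j) w.
    by rewrite mulr_sumr; apply: eq_bigr => j _; rewrite mulrA.
  have := om0 a w aQ; rewrite sumE.
  (* Off [E_k] the cap [r * q] on utility suffices; on [E_k] the surplus bound is combined with the
     bound on deliveries. *)
  have [Ekw|nEkw] := pselect (E k w); last first.
    rewrite indicE memNset// mulr0 addr0 => y0.
    rewrite (le_trans (utility_le q_gt0 Uth r0 y0))// lerDl mulr_ge0//.
    by apply: sumr_ge0 => j _; rewrite mulr_ge0.
  have := delivered_exhausted (s0 w) hlam ci x0 aQ Ekw.
  rewrite indicE mem_set// mulr1 => yle y0.
  apply: le_trans (utility_surplus q_gt0 Uth _ y0) _; first by rewrite c00.
  by rewrite lerD2l ler_pM2l.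
(* Both sides are sums of nonnegative terms, so integration is additive without integrability; the
   finite price terms change sides only at the end. *)
have expected : ('E_P[fun w => u (delivered lam i x a k.+1 w)] +
    (c0 * demand th * fine (P (E k)))%:E <=
    (marginal th * demand th + \sum_j c0 * a 0 j * fine (P (E j)))%:E)%E.
  have intI j (r1 : R) : 0 <= r1 -> (\int[P]_w (r1 * \1_(E j) w)%:E)%E =
      (r1 * fine (P (E j)))%:E.
    move=> r10; under eq_integral do rewrite EFinM.
    rewrite ge0_integralZl_EFin//; last by exact/measurable_EFinP.
    by rewrite integral_indic ?setIT ?EFinM ?fineK ?fin_num_measure//;
      exact: measurable_exhausted.
  have mcI j (r1 : R) : measurable_fun setT (fun w => (r1 * \1_(E j) w)%:E).
    by apply/measurable_EFinP; exact: measurable_funM.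
  rewrite unlock -intI ?mulr_ge0//.
  rewrite -ge0_integralD//=; last 3 first.
  - by move=> w _; rewrite lee_fin (utility_ge0 q_ge0 Uth)// om0.
  - exact/measurable_EFinP/mU.
  - by move=> w _; rewrite lee_fin !mulr_ge0//.
  apply: (@le_trans _ _ (\int[P]_w ((marginal th * demand th)%:E +
      \sum_j (c0 * a 0 j * \1_(E j) w)%:E))%E).
    apply: ge0_le_integral => //.
    - move=> w _; rewrite -EFinD lee_fin addr_ge0 ?mulr_ge0//.
      by rewrite (utility_ge0 q_ge0 Uth)// om0.
    - by apply: emeasurable_funD; [exact/measurable_EFinP/mU|exact: mcI].
    - by apply: emeasurable_funD => //; apply: emeasurable_sum => j.
    - by move=> w _; rewrite sumEFin -!EFinD lee_fin.
  rewrite ge0_integralD//=; last 3 first.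
  - by move=> w _; rewrite lee_fin mulr_ge0.
  - by move=> w _; apply: sume_ge0 => j _; rewrite lee_fin !mulr_ge0//.
  - by apply: emeasurable_sum => j.
  rewrite int_cst ge0_integral_sum//; last first.
    by move=> j w _; rewrite lee_fin !mulr_ge0//.
  rewrite EFinD leeD2l// -sumEFin le_eqVlt; apply/orP; left; apply/eqP.
  by apply: eq_bigr => j _; rewrite intI// mulr_ge0//.
have prices b : \sum_j marginal_cost_price c0 s x 0 j * b 0 j =
    \sum_j c0 * b 0 j * fine (P (E j)).
  by apply: eq_bigr => j _; rewrite marginal_cost_priceE mulrAC.
have truth_cost : \sum_j c0 * truth_telling th 0 j * fine (P (E j)) =
    c0 * demand th * fine (P (E k)).
  rewrite (bigD1 k)//= big1 ?addr0 => [|j /negPf jk]; first by rewrite mxE eqxx.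
  by rewrite mxE jk mulr0 mul0r.
rewrite !prices truth_cost -/k.
apply: le_trans (leeB truth (lexx _)).
rewrite leeBlDr// -EFinB -EFinD.
rewrite -leeBrDr// -EFinB in expected; apply: le_trans expected _.
by rewrite lee_fin; lra.
Qed.
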